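(* Let $G$ be a simplicial group and $(X,M)$ a marked simplicial set with a left $G$-action. Suppose that for all $x\in X_0$ and $g\in G_1$ the $1$-simplex $gs_0(x)$ is degenerate. Then there exists an isomorphism of marked simplicial sets $$(X,M)_G\;\cong\;(BG)^{\sharp}\,\Box_{\tau_G}\,(X,M).$$
   Context: A marked simplicial set $(X,M)$ is a simplicial set $X$ with a subset $M\subset X_1$ (marked edges) containing all degenerate $1$-simplices; morphisms are simplicial maps preserving marked edges. $Y^\sharp=(Y,Y_1)$. A simplicial group $G$ acts from the left on $(X,M)$ if it acts simplicially from the left on $X$ and $gm\in M$ for all $g\in G_1$, $m\in M$. **$BG$ and $EG$.** $(BG)_n=G_{n-1}\times\cdots\times G_0$ ($(BG)_0$ a point), with $\partial_0(g_{n-1},\dots,g_0)=(g_{n-2},\dots,g_0)$, $\partial_i(g_{n-1},\dots,g_0)=(\partial_{i-1}g_{n-1},\dots,\partial_1g_{n-i+1},\,g_{n-i-1}\cdot\partial_0g_{n-i},\,g_{n-i-2},\dots,g_0)$ for $0<i<n$, $\partial_n(g_{n-1},\dots,g_0)=(\partial_{n-1}g_{n-1},\dots,\partial_1g_1)$, and $s_0b=(1_n,g_{n-1},\dots,g_0)$, $s_ib=(s_{i-1}g_{n-1},\dots,s_0g_{n-i},1_{n-i},g_{n-i-1},\dots,g_0)$ for $b=(g_{n-1},\dots,g_0)$ and $i\geq 1$. The twisting function $\tau_G\colon(BG)_{n+1}=G_n\times\cdots\times G_0\to G_n$ is the projection onto the first factor. The total space $EG$ of the universal bundle has $(EG)_n=G_n\times(BG)_n$,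 $\partial_0(g,b)=(\tau_G(b)\cdot\partial_0g,\partial_0b)$, $\partial_i(g,b)=(\partial_ig,\partial_ib)$ for $i>0$, $s_i(g,b)=(s_ig,s_ib)$. **Borel construction.** $EG\times_GX=(EG\times X)/G$, where $h\in G_n$ acts by $h(g_n,g_{n-1},\dots,g_0,x)=(g_nh,g_{n-1},\dots,g_0,h^{-1}x)$. Put $(EG)_1\Box M=(EG)_1\times s_0(X_0)\,\cup\,s_0((EG)_0)\times M$. The Borel construction of $(X,M)$ is the marked simplicial set $(X,M)_G=\big(EG\times_GX,\ ((EG)_1\Box M)/G_1\big)$, whose marked edges are the $G_1$-orbits of elements of $(EG)_1\Box M$. **Marked twisted Cartesian product.** $(BG)^\sharp\Box_{\tau_G}(X,M)$ has underlying simplicial set $BG\times_{\tau_G}X$, with $n$-simplices $(BG)_n\times X_n$, $\partial_0(b,x)=(\partial_0b,\tau_G(b)\cdot\partial_0x)$, $\partial_i(b,x)=(\partial_ib,\partial_ix)$ for $i>0$, $s_i(b,x)=(s_ib,s_ix)$, and marked edges $s_0((BG)_0)\times M\,\cup\,(BG)_1\times s_0(X_0)$. *)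

(* Defs.v *)
From HB Require Import structures.
From mathcomp Require Import all_boot.
From mathcomp Require Import boolp classical_sets.

Set Implicit Arguments.
Unset Strict Implicit.
Unset Printing Implicit Defensive.

Local Open Scope classical_set_scope.

(* In the simplicial identities, [lift ord0 j] is the index j + 1 and
   [lift ord_max i] is the index i seen in the next larger ordinal. *)
Record simplicial_identities (S : nat -> Type)
    (d : forall n, 'I_n.+2 -> S n.+1 -> S n)
    (s : forall n, 'I_n.+1 -> S n -> S n.+1) : Prop := SimplicialIdentities {
  simpl_dd : forall n (i j : 'I_n.+2) (x : S n.+2), i <= j ->
    d n i (d n.+1 (lift ord0 j) x) = d n j (d n.+1 (lift ord_max i) x);
  simpl_ss : forall n (i j : 'I_n.+1) (x : S n), i <= j ->
    s n.+1 (lift ord_max i) (s n j x) = s n.+1 (lift ord0 j) (s n i x);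
  simpl_ds_lt : forall n (i : 'I_n.+2) (j : 'I_n.+1) (x : S n.+1), i <= j ->
    d n.+1 (lift ord_max i) (s n.+1 (lift ord0 j) x) = s n j (d n i x);
  simpl_ds_eq : forall n (j : 'I_n.+1) (x : S n),
    d n (lift ord_max j) (s n j x) = x;
  simpl_ds_eqS : forall n (j : 'I_n.+1) (x : S n),
    d n (lift ord0 j) (s n j x) = x;
  simpl_ds_gt : forall n (i : 'I_n.+2) (j : 'I_n.+1) (x : S n.+1), j < i ->
    d n.+1 (lift ord0 i) (s n.+1 (lift ord_max j) x) = s n j (d n i x)
}.

Record sset := SSet {
  simplex :> nat -> Type;
  face : forall n, 'I_n.+2 -> simplex n.+1 -> simplex n;
  degen : forall n, 'I_n.+1 -> simplex n -> simplex n.+1;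
  ssetP : simplicial_identities face degen
}.

Record sset_hom (X Y : sset) := SSetHom {
  shom :> forall n, X n -> Y n;
  shom_face : forall n (i : 'I_n.+2) (x : X n.+1),
    shom (face i x) = face i (shom x);
  shom_degen : forall n (i : 'I_n.+1) (x : X n),
    shom (degen i x) = degen i (shom x)
}.

Record msset := MSSet {
  underlying :> sset;
  marked : set (underlying 1);
  marked_degen : forall x : underlying 0, marked (degen ord0 x)
}.

Record msset_hom (X Y : msset) := MSSetHom {
  mshom :> sset_hom X Y;
  mshom_marked : forall m : X 1, marked m -> marked (shom mshom m)
}.

Definition msset_isomorphic (X Y : msset) : Prop :=
  exists (f : msset_hom X Y) (g : msset_hom Y X),
    forall n, cancel (@shom _ _ f n) (@shom _ _ g n) /\
              cancel (@shom _ _ g n) (@shom _ _ f n).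

Notation group_hom := UMagmaMorphism.type.

Record sgroup := SGroup {
  gsimplex :> nat -> groupType;
  gface : forall n, 'I_n.+2 -> group_hom (gsimplex n.+1) (gsimplex n);
  gdegen : forall n, 'I_n.+1 -> group_hom (gsimplex n) (gsimplex n.+1);
  sgroupP : simplicial_identities (fun n i x => gface i x)
                                  (fun n i x => gdegen i x)
}.

Arguments gface {s n} i.
Arguments gdegen {s n} i.

Record saction (G : sgroup) (X : sset) := SAction {
  sact :> forall n, G n -> X n -> X n;
  sact1 : forall n (x : X n), sact 1%g x = x;
  sactM : forall n (g h : G n) (x : X n), sact (g * h)%g x = sact g (sact h x);
  sact_face : forall n (i : 'I_n.+2) (g : G n.+1) (x : X n.+1),
    face i (sact g x) = sact (gface i g) (face i x);
  sact_degen : forall n (i : 'I_n.+1) (g : G n) (x : X n),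
    degen i (sact g x) = sact (gdegen i g) (degen i x)
}.

Record msaction (G : sgroup) (X : msset) := MSAction {
  msact :> saction G X;
  msact_marked : forall (g : G 1) (m : X 1), marked m -> marked (sact msact g m)
}.

Definition degenerate_edge (X : sset) : set (X 1) :=
  range (fun x : X 0 => degen ord0 x).

Arguments degenerate_edge : clear implicits.

(* (Y_1 x s_0(X_0)) \cup (s_0(Y_0) x M). *)
Definition box_edges (Y : sset) (X : msset) : set (Y 1 * X 1)%type :=
  (setT `*` degenerate_edge X) `|` (degenerate_edge Y `*` @marked X).

Arguments box_edges : clear implicits.

Section ClassifyingSpace.
Variable G : sgroup.

(* The n-simplex (g_{n-1}, ..., g_0) is the nested pair
   (g_{n-1}, (g_{n-2}, (..., (g_0, tt)))). *)
Fixpoint bar (n : nat) : Type := if n is m.+1 then (G m * bar m)%type else unit.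

(* The twisting function tau_G: the projection onto the first factor. *)
Definition bar_twist n (b : bar n.+1) : G n := b.1.

(* The faces and degeneracies are given by recursion:
     d_0 (g, b) = b,   d_1 (g, b) = (tau b * d_0 g, d_0 b),
     d_{j+1} (g, b) = (d_j g, d_j b)  for j >= 1,
     s_0 b = (1, b),   s_{j+1} (g, b) = (s_j g, s_j b),
   both faces of a 1-simplex being the point.  The lemmas [bar_coord_face] and
   [bar_coord_degen] give the closed formulas. *)
Fixpoint bar_face (n : nat) : 'I_n.+2 -> bar n.+1 -> bar n :=
  match n return 'I_n.+2 -> bar n.+1 -> bar n with
  | 0 => fun _ _ => tt
  | m.+1 => fun i p =>
      let: (g, b) := p in
      if unlift ord0 i is Some j then
        if j == ord0 then ((bar_twist b * gface ord0 g)%g, b.2)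
        else (gface j g, bar_face j b)
      else b
  end.

Fixpoint bar_degen (n : nat) : 'I_n.+1 -> bar n -> bar n.+1 :=
  match n return 'I_n.+1 -> bar n -> bar n.+1 with
  | 0 => fun _ b => (1%g, b)
  | m.+1 => fun i b =>
      if unlift ord0 i is Some j then (gdegen j b.1, bar_degen j b.2)
      else (1%g, b)
  end.

Lemma bar_face0 n (b : bar n.+1) : bar_face ord0 b = b.2.
Proof. by case: n b => [|n] [g b] /=; [case: b | rewrite unlift_none]. Qed.

Lemma bar_face1 n (g : G n.+1) (b : bar n.+1) :
  @bar_face n.+1 (lift ord0 ord0) (g, b)
  = ((bar_twist b * gface ord0 g)%g, bar_face ord0 b).
Proof. by rewrite bar_face0 /= liftK eqxx. Qed.

Lemma bar_faceS n (j : 'I_n.+2) (g : G n.+1) (b : bar n.+1) : j != ord0 ->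
  @bar_face n.+1 (lift ord0 j) (g, b) = (gface j g, bar_face j b).
Proof. by move=> /negPf j0; rewrite /= liftK j0. Qed.

Lemma bar_degen0 n (b : bar n) : bar_degen ord0 b = (1%g, b).
Proof. by case: n b => [|n] b //=; rewrite unlift_none. Qed.

Lemma bar_degenS n (j : 'I_n.+1) (g : G n) (b : bar n) :
  @bar_degen n.+1 (lift ord0 j) (g, b) = (gdegen j g, bar_degen j b).
Proof. by rewrite /= liftK. Qed.

Lemma bar_face_snd n (j : 'I_n.+2) (p : bar n.+2) :
  (bar_face (lift ord0 j) p).2 = bar_face j p.2.
Proof.
case: p => g b; have [->|j0] := eqVneq j ord0.
  by rewrite bar_face1.
by rewrite bar_faceS.
Qed.

Lemma lift_max_lift0 n (i : 'I_n) :
  lift ord_max (lift ord0 i) = lift ord0 (lift ord_max i).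
Proof. by apply: ord_inj; rewrite lift_max [RHS]lift0 lift_max lift0. Qed.

Lemma lift_max0 n : lift ord_max (ord0 : 'I_n.+1) = ord0.
Proof. exact: val_inj. Qed.

Lemma leq_lift0 m n (i : 'I_m) (j : 'I_n) : (lift ord0 i <= lift ord0 j) = (i <= j).
Proof. by []. Qed.

Lemma lift0_neq0 n (i : 'I_n) : lift ord0 i != ord0.
Proof. by []. Qed.

Lemma lift_max_neq0 n (i : 'I_n.+1) : i != ord0 -> lift ord_max i != ord0.
Proof. by case: (unliftP ord0 i) => [j|] -> //; rewrite lift_max_lift0. Qed.

Let gdd := simpl_dd (sgroupP G).

Lemma bar_dd n (i j : 'I_n.+2) (x : bar n.+2) : i <= j ->
  bar_face i (bar_face (lift ord0 j) x) = bar_face j (bar_face (lift ord_max i) x).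
Proof.
elim: n i j x => [|n IH] i j x //.
case: (unliftP ord0 i) => [i'|] ->{i}; last first.
  by rewrite lift_max0 !bar_face0 bar_face_snd.
case: (unliftP ord0 j) => [j'|] ->{j} //; rewrite leq_lift0 lift_max_lift0 => ij.
case: x => g b; rewrite bar_faceS ?lift0_neq0//.
have [i0|i0] := eqVneq i' ord0.
  rewrite i0 bar_face1 lift_max0 bar_face1 !bar_face0; case: b => g' b.
  have [->|j0] := eqVneq j' ord0.
    by rewrite !bar_face1 !bar_face0 /= gmulfM mulgA gdd// lift_max0.
  by rewrite !bar_faceS// gmulfM /= gdd// lift_max0.
have j0 : j' != ord0.
  by apply: contraNneq i0 => j0; move: ij; rewrite j0 leqn0.
rewrite !bar_faceS ?lift_max_neq0//.
by rewrite gdd// IH.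
Qed.

Lemma bar_ss n (i j : 'I_n.+1) (x : bar n) : i <= j ->
  bar_degen (lift ord_max i) (bar_degen j x)
  = bar_degen (lift ord0 j) (bar_degen i x).
Proof.
elim: n i j x => [|n IH] i j x.
  by rewrite !(ord1 i) !(ord1 j) lift_max0 !bar_degen0 bar_degenS gmulf1 bar_degen0.
case: (unliftP ord0 i) => [i'|] ->{i}; last first.
  by rewrite lift_max0 !bar_degen0 bar_degenS gmulf1.
case: (unliftP ord0 j) => [j'|] ->{j} //; rewrite leq_lift0 lift_max_lift0 => ij.
by case: x => g b; rewrite !bar_degenS IH// (simpl_ss (sgroupP G)).
Qed.

Lemma bar_twist_degen n (j : 'I_n.+1) (b : bar n.+1) :
  bar_twist (bar_degen (lift ord0 j) b) = gdegen j (bar_twist b).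
Proof. by case: b => g b; rewrite bar_degenS. Qed.

Lemma bar_ds_eq n (j : 'I_n.+1) (x : bar n) :
  bar_face (lift ord_max j) (bar_degen j x) = x.
Proof.
elim: n j x => [|n IH] j x; first by case: x.
case: (unliftP ord0 j) => [j'|] ->{j}; last first.
  by rewrite lift_max0 bar_face0 bar_degen0.
case: x => g b; rewrite bar_degenS lift_max_lift0.
have [j0|j0] := eqVneq (lift ord_max j') ord0.
  have -> : j' = ord0.
    by apply: ord_inj; rewrite -lift_max j0.
  rewrite lift_max0 bar_degen0 bar_face1 bar_face0 /=.
  by have /= := simpl_ds_eq (sgroupP G) ord0 g; rewrite lift_max0 mul1g => ->.
by rewrite bar_faceS// IH (simpl_ds_eq (sgroupP G)).
Qed.

Lemma bar_ds_eqS n (j : 'I_n.+1) (x : bar n) :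
  bar_face (lift ord0 j) (bar_degen j x) = x.
Proof.
elim: n j x => [|n IH] j x; first by case: x.
case: (unliftP ord0 j) => [j'|] ->{j}; last first.
  by case: x => g b; rewrite bar_degen0 bar_face1 gmulf1 mulg1 bar_face0.
by case: x => g b; rewrite bar_degenS bar_faceS// IH (simpl_ds_eqS (sgroupP G)).
Qed.

Lemma bar_ds_lt n (i : 'I_n.+2) (j : 'I_n.+1) (x : bar n.+1) : i <= j ->
  bar_face (lift ord_max i) (bar_degen (lift ord0 j) x)
  = bar_degen j (bar_face i x).
Proof.
elim: n i j x => [|n IH] i j x.
  case: (unliftP ord0 i) => [i'|] ->{i}; first by rewrite (ord1 j).
  by case: x => g b _; rewrite lift_max0 bar_degenS !bar_face0.
case: (unliftP ord0 i) => [i'|] ->{i}; last first.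
  by case: x => g b _; rewrite lift_max0 bar_degenS !bar_face0.
case: (unliftP ord0 j) => [j'|] ->{j} //; rewrite leq_lift0 lift_max_lift0 => ij.
case: x => g b; rewrite bar_degenS.
have [i0|i0] := eqVneq i' ord0.
  rewrite i0 lift_max0 !bar_face1 bar_degenS bar_twist_degen gmulfM.
  congr (_ * _, _)%g.
    by rewrite -(simpl_ds_lt (sgroupP G)) ?lift_max0.
  by rewrite -IH// lift_max0.
rewrite !bar_faceS ?lift_max_neq0// bar_degenS IH//.
by rewrite (simpl_ds_lt (sgroupP G)).
Qed.

Lemma bar_ds_gt n (i : 'I_n.+2) (j : 'I_n.+1) (x : bar n.+1) : j < i ->
  bar_face (lift ord0 i) (bar_degen (lift ord_max j) x)
  = bar_degen j (bar_face i x).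
Proof.
elim: n i j x => [|n IH] i j x.
  rewrite (ord1 j) lift_max0 bar_degen0; case: (unliftP ord0 i) => [i'|] -> // _.
  by rewrite bar_faceS// bar_degen0 gmulf1 (ord1 i').
case: (unliftP ord0 j) => [j'|] ->{j}; last first.
  rewrite lift_max0 !bar_degen0; case: (unliftP ord0 i) => [i'|] -> // _.
  by rewrite bar_faceS// gmulf1.
case: (unliftP ord0 i) => [i'|] ->{i} //; rewrite lift_max_lift0 => ij.
case: x => g b; rewrite bar_degenS bar_faceS//.
have i0 : i' != ord0.
  by apply: contraTneq ij => ->.
rewrite !bar_faceS// bar_degenS IH//.
by rewrite (simpl_ds_gt (sgroupP G)).
Qed.

Lemma barP : simplicial_identities bar_face bar_degen.
Proof.
split; [exact: bar_dd | exact: bar_ss | exact: bar_ds_lt | exact: bar_ds_eq |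
        exact: bar_ds_eqS | exact: bar_ds_gt].
Qed.

(* The component g_k of (g_{n-1}, ..., g_0), for k < n. *)
Fixpoint bar_coord (n : nat) : bar n -> forall k : nat, G k :=
  match n return bar n -> forall k, G k with
  | 0 => fun _ k => 1%g
  | m.+1 => fun b k =>
      if m =P k is ReflectT e then ecast l (G l) e b.1 else bar_coord b.2 k
  end.

Lemma bar_coord_top n (b : bar n.+1) : bar_coord b n = b.1.
Proof. by rewrite /=; case: eqP => // e; rewrite eq_axiomK. Qed.

Lemma bar_coord_lt n (b : bar n.+1) k : k < n -> bar_coord b k = bar_coord b.2 k.
Proof. by move=> /= ltkn; case: eqP => // e; rewrite e ltnn in ltkn. Qed.

Lemma bar_coord_face n (i : 'I_n.+2) (b : bar n.+1) k : k < n ->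
  bar_coord (bar_face i b) k =
    if k + i < n then bar_coord b k
    else if k + i == n then (bar_coord b k * gface ord0 (bar_coord b k.+1))%g
    else gface (inord (k + i - n)) (bar_coord b k.+1).
Proof.
elim: n k i b => [|n IH] k i b // ltkn.
case: (unliftP ord0 i) => [j|] ->{i}; last first.
  by rewrite bar_face0 addn0 ltkn (@bar_coord_lt n.+1).
have topE := @bar_coord_top n.+1 b; have ltE := @bar_coord_lt n.+1 b.
have faceE := bar_face_snd j b.
move: topE ltE faceE; case: b => g b topE ltE faceE; rewrite lift0 addnS ltnS.
have [kn|kn] := eqVneq k n.
  move: kn => {}kn; subst k; rewrite topE ltE// [(g, b).1]/= [(g, b).2]/=.
  rewrite !bar_coord_top eqSS subSS.
  have [->|j0] := eqVneq j ord0.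
    by rewrite bar_face1 addn0 ltnn eqxx.
  have jgt0 : 0 < j.
    by rewrite lt0n; apply: contraNneq j0 => j0; apply/eqP/ord_inj.
  rewrite bar_faceS// -[X in _ < X]addn0 ltn_add2l ltnNge ltnW//=.
  by rewrite -[X in _ == X]addn0 eqn_add2l gtn_eqF// addKn inord_val.
have {kn}ltkn' : k < n by rewrite ltn_neqAle kn -ltnS.
rewrite (@bar_coord_lt n)// faceE IH// [in RHS]ltE// [in RHS]ltE//.
Qed.

Lemma bar_coord_degen n (i : 'I_n.+1) (b : bar n) :
  [/\ forall k, k + i < n -> bar_coord (bar_degen i b) k = bar_coord b k,
      bar_coord (bar_degen i b) (n - i) = 1%g &
      forall k, n <= k + i -> k < n ->
        bar_coord (bar_degen i b) k.+1
        = gdegen (inord (k + i - n)) (bar_coord b k)].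
Proof.
elim: n i b => [|n IH] i b.
  by rewrite (ord1 i) bar_degen0; split => //; rewrite bar_coord_top.
case: (unliftP ord0 i) => [j|] ->{i}; last first.
  rewrite bar_degen0; split=> [k||k]; last by rewrite addn0 => nk; rewrite ltnNge nk.
    by rewrite addn0 => kn; rewrite bar_coord_lt.
  by rewrite subn0 bar_coord_top.
have topE := @bar_coord_top n b; have ltE := @bar_coord_lt n b.
move: topE ltE; case: b => g b topE ltE; have [IHlt IHeq IHgt] := IH j b.
rewrite bar_degenS; split=> [k||k].
- rewrite lift0 addnS ltnS => kjn.
  have ltkn : k < n by apply: leq_ltn_trans kjn; rewrite leq_addr.
  rewrite [RHS]ltE// -[RHS]IHlt//; apply: (@bar_coord_lt n.+1); exact: ltnW.
- rewrite lift0 subSS -[RHS]IHeq; apply: (@bar_coord_lt n.+1).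
  by rewrite ltnS leq_subr.
- rewrite lift0 addnS ltnS => nkj ltkn; rewrite subSS.
  have [kn|kn] := eqVneq k n.
    by subst k; rewrite topE (@bar_coord_top n.+1) addKn inord_val.
  have {kn}ltkn' : k < n by rewrite ltn_neqAle kn -ltnS.
  rewrite ltE// -[RHS]IHgt//; exact: (@bar_coord_lt n.+1).
Qed.

End ClassifyingSpace.

Arguments bar_face G n i p : simpl never.
Arguments bar_degen G n i b : simpl never.

Definition classifying_space (G : sgroup) : sset := SSet (barP G).

Section UniversalBundle.
Variable G : sgroup.
Local Notation BG := (classifying_space G).

Definition universal_simplex (n : nat) : Type := (G n * BG n)%type.

Definition universal_face n (i : 'I_n.+2) (e : universal_simplex n.+1) :
    universal_simplex n :=
  (if i == ord0 then (bar_twist e.2 * gface ord0 e.1)%g else gface i e.1,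
   face i e.2).

Definition universal_degen n (i : 'I_n.+1) (e : universal_simplex n) :
    universal_simplex n.+1 :=
  (gdegen i e.1, degen i e.2).

Lemma universal_faceE n (i : 'I_n.+2) (e : universal_simplex n.+1) :
  universal_face i e = @bar_face G n.+1 (lift ord0 i) e.
Proof.
case: e => g b; rewrite /universal_face; have [->|i0] := eqVneq i ord0.
  by rewrite bar_face1.
by rewrite bar_faceS.
Qed.

Lemma universal_degenE n (i : 'I_n.+1) (e : universal_simplex n) :
  universal_degen i e = @bar_degen G n.+1 (lift ord0 i) e.
Proof. by case: e => g b; rewrite bar_degenS. Qed.

Lemma universalP : simplicial_identities universal_face universal_degen.
Proof.
split=> n; rewrite ?/universal_simplex.
- move=> i j x ij; rewrite !universal_faceE -lift_max_lift0.
  exact: (@bar_dd G n.+1 (lift ord0 i) (lift ord0 j)).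
- move=> i j x ij; rewrite !universal_degenE -lift_max_lift0.
  exact: (@bar_ss G n.+1 (lift ord0 i) (lift ord0 j)).
- move=> i j x ij; rewrite !universal_faceE !universal_degenE -lift_max_lift0.
  exact: (@bar_ds_lt G n.+1 (lift ord0 i) (lift ord0 j)).
- move=> j x; rewrite !universal_faceE !universal_degenE -lift_max_lift0.
  exact: (@bar_ds_eq G n.+1 (lift ord0 j)).
- move=> j x; rewrite !universal_faceE !universal_degenE.
  exact: (@bar_ds_eqS G n.+1 (lift ord0 j)).
- move=> i j x ij; rewrite !universal_faceE !universal_degenE -lift_max_lift0.
  exact: (@bar_ds_gt G n.+1 (lift ord0 i) (lift ord0 j)).
Qed.

Definition universal_bundle : sset := SSet universalP.

End UniversalBundle.

Section Product.
Variables X Y : sset.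

Definition prod_simplex (n : nat) : Type := (X n * Y n)%type.

Definition prod_face n (i : 'I_n.+2) (p : prod_simplex n.+1) : prod_simplex n :=
  (face i p.1, face i p.2).

Definition prod_degen n (i : 'I_n.+1) (p : prod_simplex n) :
    prod_simplex n.+1 :=
  (degen i p.1, degen i p.2).

Lemma prodP : simplicial_identities prod_face prod_degen.
Proof.
split=> n; rewrite /prod_face /prod_degen /=.
- by move=> i j p ij; rewrite !(simpl_dd (ssetP _) _ ij).
- by move=> i j p ij; rewrite !(simpl_ss (ssetP _) _ ij).
- by move=> i j p ij; rewrite !(simpl_ds_lt (ssetP _) _ ij).
- by move=> j [x y]; rewrite !(simpl_ds_eq (ssetP _)).
- by move=> j [x y]; rewrite !(simpl_ds_eqS (ssetP _)).
- by move=> i j p ij; rewrite !(simpl_ds_gt (ssetP _) _ ij).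
Qed.

Definition sset_prod : sset := SSet prodP.

End Product.

Section BorelConstruction.
Variable G : sgroup.
Local Notation EG := (universal_bundle G).

Section Underlying.
Variables (X : sset) (a : saction G X).
Local Notation EGX := (sset_prod EG X).

Definition borel_act n (h : G n) (p : EGX n) : EGX n :=
  (((p.1.1 * h)%g, p.1.2), sact a h^-1%g p.2).

Definition borel_orbit n (p : EGX n) : set (EGX n) :=
  range (fun h : G n => borel_act h p).

(* The n-simplices of (EG x X) / G are the orbits themselves. *)
Definition borel_simplex (n : nat) : Type :=
  {O : set (EGX n) | exists p, O = borel_orbit p}.

Definition borel_class n (p : EGX n) : borel_simplex n :=
  exist _ (borel_orbit p) (ex_intro _ p erefl).

Definition borel_repr n (O : borel_simplex n) : EGX n :=
  projT1 (cid (proj2_sig O)).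

(* Independence of the representatives is shown by [borel_faceE] and
   [borel_degenE]. *)
Definition borel_face n (i : 'I_n.+2) (O : borel_simplex n.+1) :
    borel_simplex n :=
  borel_class (face i (borel_repr O)).

Definition borel_degen n (i : 'I_n.+1) (O : borel_simplex n) :
    borel_simplex n.+1 :=
  borel_class (degen i (borel_repr O)).

Lemma borel_actM n (h k : G n) (p : EGX n) :
  borel_act k (borel_act h p) = borel_act (h * k)%g p.
Proof. by rewrite /borel_act /= mulgA invgM sactM. Qed.

Lemma borel_act1 n (p : EGX n) : borel_act 1%g p = p.
Proof. by case: p => [[g b] x]; rewrite /borel_act /= mulg1 invg1 sact1. Qed.

Lemma borel_face_act n (i : 'I_n.+2) (h : G n.+1) (p : EGX n.+1) :
  face i (borel_act h p) = borel_act (gface i h) (face i p).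
Proof.
case: p => [[g b] x]; rewrite /borel_act /= /prod_face /= sact_face gmulfV.
rewrite /universal_face /=; case: eqP => [->|_] /=.
  by rewrite gmulfM mulgA.
by rewrite gmulfM.
Qed.

Lemma borel_degen_act n (i : 'I_n.+1) (h : G n) (p : EGX n) :
  degen i (borel_act h p) = borel_act (gdegen i h) (degen i p).
Proof.
case: p => [[g b] x]; rewrite /borel_act /= /prod_degen /= sact_degen gmulfV.
by rewrite /universal_degen /= gmulfM.
Qed.

Lemma borel_class_act n (h : G n) (p : EGX n) :
  borel_class (borel_act h p) = borel_class p.
Proof.
apply: eq_exist; apply/seteqP; split=> q [k _ <-].
  by exists (h * k)%g; rewrite // borel_actM.
by exists (h^-1 * k)%g; rewrite // borel_actM mulVKg.
Qed.

Lemma borel_class_eqP n (p q : EGX n) :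
  borel_class p = borel_class q <-> exists h, q = borel_act h p.
Proof.
split=> [/(congr1 (@proj1_sig _ _)) /= pq|[h ->]]; last by rewrite borel_class_act.
have : borel_orbit q q by exists 1%g; rewrite // borel_act1.
by rewrite -pq => -[h _ <-]; exists h.
Qed.

Lemma borel_reprK n (O : borel_simplex n) : borel_class (borel_repr O) = O.
Proof.
rewrite /borel_repr; case: O => O Op; case: cid => p /= Opp.
exact: eq_exist.
Qed.

Lemma borel_faceE n (i : 'I_n.+2) (p : EGX n.+1) :
  borel_face i (borel_class p) = borel_class (face i p).
Proof.
have /borel_class_eqP[h hp] := esym (borel_reprK (borel_class p)).
by rewrite /borel_face hp borel_face_act borel_class_act.
Qed.

Lemma borel_degenE n (i : 'I_n.+1) (p : EGX n) :
  borel_degen i (borel_class p) = borel_class (degen i p).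
Proof.
have /borel_class_eqP[h hp] := esym (borel_reprK (borel_class p)).
by rewrite /borel_degen hp borel_degen_act borel_class_act.
Qed.

Lemma borelP : simplicial_identities borel_face borel_degen.
Proof.
have EGXP := ssetP EGX.
split=> n.
- move=> i j O ij; rewrite -(borel_reprK O) !borel_faceE; congr borel_class.
  exact: simpl_dd EGXP _ _ _ _ ij.
- move=> i j O ij; rewrite -(borel_reprK O) !borel_degenE; congr borel_class.
  exact: simpl_ss EGXP _ _ _ _ ij.
- move=> i j O ij; rewrite -(borel_reprK O) !(borel_faceE, borel_degenE).
  congr borel_class; exact: simpl_ds_lt EGXP _ _ _ _ ij.
- move=> j O; rewrite -{2}(borel_reprK O) -{1}(borel_reprK O).
  rewrite !(borel_faceE, borel_degenE).
  congr borel_class; exact: simpl_ds_eq EGXP _ _ _.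
- move=> j O; rewrite -{2}(borel_reprK O) -{1}(borel_reprK O).
  rewrite !(borel_faceE, borel_degenE).
  congr borel_class; exact: simpl_ds_eqS EGXP _ _ _.
- move=> i j O ij; rewrite -(borel_reprK O) !(borel_faceE, borel_degenE).
  congr borel_class; exact: simpl_ds_gt EGXP _ _ _ _ ij.
Qed.

Definition borel_construction : sset := SSet borelP.

End Underlying.

Variables (X : msset) (a : msaction G X).

Definition borel_marked : set (borel_construction a 1) :=
  @borel_class X a 1 @` box_edges EG X.

Lemma borel_marked_degen (O : borel_construction a 0) :
  borel_marked (degen ord0 O).
Proof.
rewrite /= -(borel_reprK O) borel_degenE; exists (degen ord0 (borel_repr O)) => //.
by left; split => //; exists (borel_repr O).2.
Qed.

Definition marked_borel_construction : msset := MSSet borel_marked_degen.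

End BorelConstruction.

Section TwistedProduct.
Variable G : sgroup.
Local Notation BG := (classifying_space G).

Section Underlying.
Variables (X : sset) (a : saction G X).

Definition twisted_simplex (n : nat) : Type := (BG n * X n)%type.

Definition twisted_face n (i : 'I_n.+2) (p : twisted_simplex n.+1) :
    twisted_simplex n :=
  (face i p.1,
   if i == ord0 then sact a (bar_twist p.1) (face ord0 p.2) else face i p.2).

Definition twisted_degen n (i : 'I_n.+1) (p : twisted_simplex n) :
    twisted_simplex n.+1 :=
  (degen i p.1, degen i p.2).

Lemma twisted_dd n (i j : 'I_n.+2) (p : twisted_simplex n.+2) : i <= j ->
  twisted_face i (twisted_face (lift ord0 j) p)
  = twisted_face j (twisted_face (lift ord_max i) p).
Proof.
case: p => [[g b] x] ij; rewrite /twisted_face /= (bar_dd _ ij); congr pair.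
have [i0|i0] := eqVneq i ord0.
  rewrite i0 lift_max0 eqxx bar_face0 /=.
  have [j0|j0] := eqVneq j ord0.
    rewrite j0 bar_face1 /= sactM sact_face.
    by rewrite (simpl_dd (ssetP X))// lift_max0.
  rewrite bar_faceS//= sact_face.
  by rewrite (simpl_dd (ssetP X))// lift_max0.
have j0 : j != ord0.
  by apply: contraNneq i0 => j0; move: ij; rewrite j0 leqn0.
rewrite (negPf (lift_max_neq0 i0)) (negPf j0).
exact: (simpl_dd (ssetP X)).
Qed.

Lemma twistedP : simplicial_identities twisted_face twisted_degen.
Proof.
split=> n.
- exact: twisted_dd.
- move=> i j [b x] ij; rewrite /twisted_degen /= bar_ss//.
  by rewrite (simpl_ss (ssetP X)).
- move=> i j [[g b] x] ij; rewrite /twisted_face /twisted_degen /= bar_ds_lt//.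
  congr pair; have [i0|i0] := eqVneq i ord0; last first.
    by rewrite (negPf (lift_max_neq0 i0)) (simpl_ds_lt (ssetP X)).
  rewrite i0 lift_max0 eqxx bar_degenS /= sact_degen.
  by rewrite -(simpl_ds_lt (ssetP X)) ?lift_max0.
- move=> j [b x]; rewrite /twisted_face /twisted_degen /= bar_ds_eq.
  congr pair; case: eqP => [j0|_]; last exact: (simpl_ds_eq (ssetP X)).
  have -> : j = ord0 by apply: ord_inj; rewrite -lift_max j0.
  rewrite bar_degen0 sact1 -{1}(lift_max0 n).
  exact: (simpl_ds_eq (ssetP X)).
- move=> j [b x]; rewrite /twisted_face /twisted_degen /= bar_ds_eqS.
  by rewrite (simpl_ds_eqS (ssetP X)).
- move=> i j [b x] ij; rewrite /twisted_face /twisted_degen /= bar_ds_gt//.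
  have i0 : i != ord0 by apply: contraTneq ij => ->.
  by rewrite (negPf i0) (simpl_ds_gt (ssetP X)).
Qed.

Definition twisted_product : sset := SSet twistedP.

End Underlying.

Variables (X : msset) (a : msaction G X).

Lemma twisted_marked_degen (p : twisted_product a 0) :
  box_edges BG X (degen ord0 p).
Proof. by left; split => //; exists p.2. Qed.

Definition marked_twisted_product : msset := MSSet twisted_marked_degen.

End TwistedProduct.

(* Main.v *)
(* The shear ((g, b), x) |-> (b, g x) is constant on G-orbits, and each orbit
   has exactly one representative of the form ((1, b), x).  The hypothesis on
   degenerate 1-simplices is what makes the shear preserve the marked edges
   ((g, b), s_0 y). *)
Require Import Defs.
From mathcomp Require Import all_boot.

Set Implicit Arguments.
Unset Strict Implicit.
Unset Printing Implicit Defensive.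

Section ShearMap.
Variables (G : sgroup) (X : sset) (a : saction G X).
Local Notation EGX := (sset_prod (universal_bundle G) X).

Definition shear n (p : EGX n) : twisted_product a n :=
  (p.1.2, sact a p.1.1 p.2).

Lemma shear_act n (h : G n) (p : EGX n) : shear (borel_act a h p) = shear p.
Proof. by rewrite /shear /= -sactM mulgK. Qed.

(** For [i = ord0] both sides have second coordinate $\tau(b)\cdot\partial_0 g\cdot\partial_0 x$:
    the twist carried by the group coordinate of $EG$ becomes the twist of the product. *)
Lemma shear_face n (i : 'I_n.+2) (p : EGX n.+1) :
  shear (face i p) = face i (shear p).
Proof.
case: p => [[g b] x]; rewrite /shear /= /twisted_face /=; congr pair.
by rewrite /universal_face; case: eqP => [->|_] /=; rewrite sact_face ?sactM.
Qed.

Lemma shear_degen n (i : 'I_n.+1) (p : EGX n) :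
  shear (degen i p) = degen i (shear p).
Proof. by rewrite /shear /= /twisted_degen /= sact_degen. Qed.

(** Evaluated at a chosen representative; [borel_shearE] shows that the choice does not matter. *)
Definition borel_shear n (O : borel_construction a n) : twisted_product a n :=
  shear (borel_repr O).

Lemma borel_shearE n (p : EGX n) : borel_shear (borel_class a p) = shear p.
Proof.
have /borel_class_eqP[h hp] := esym (borel_reprK (borel_class a p)).
by rewrite /borel_shear hp shear_act.
Qed.

Lemma borel_shear_face n (i : 'I_n.+2) (O : borel_construction a n.+1) :
  borel_shear (face i O) = face i (borel_shear O).
Proof. by rewrite /= /borel_face borel_shearE shear_face. Qed.

Lemma borel_shear_degen n (i : 'I_n.+1) (O : borel_construction a n) :
  borel_shear (degen i O) = degen i (borel_shear O).
Proof. by rewrite /= /borel_degen borel_shearE shear_degen. Qed.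

Definition borel_shear_hom : sset_hom (borel_construction a) (twisted_product a) :=
  SSetHom borel_shear_face borel_shear_degen.

(** This section commutes with $\partial_0$ only up to the $G$-action, since
    $\partial_0(1,b)=(\tau(b),\partial_0 b)$; hence the passage to orbits in [unshear]. *)
Definition unit_section n (p : twisted_product a n) : EGX n :=
  ((1%g, p.1), p.2).

Definition unshear n (p : twisted_product a n) : borel_construction a n :=
  borel_class a (unit_section p).

Lemma unshear_face n (i : 'I_n.+2) (p : twisted_product a n.+1) :
  unshear (face i p) = face i (unshear p).
Proof.
case: p => b x; rewrite /= borel_faceE; apply/borel_class_eqP.
have [->|i0] := eqVneq i ord0; last first.
  exists 1%g; rewrite borel_act1 /unit_section /= /prod_face /twisted_face.
  by rewrite /= /universal_face (negPf i0) gmulf1.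
(* Acting by $\tau(b)$ takes $((1,\partial_0 b),\tau(b)\cdot\partial_0 x)$ to $((\tau(b),\partial_0
   b),\partial_0 x)$. *)
exists (bar_twist b).
rewrite /unit_section /borel_act /= /prod_face /= /universal_face eqxx /=.
by rewrite gmulf1 mulg1 mul1g -sactM mulVg sact1.
Qed.

Lemma unshear_degen n (i : 'I_n.+1) (p : twisted_product a n) :
  unshear (degen i p) = degen i (unshear p).
Proof.
rewrite /= borel_degenE; congr borel_class.
by rewrite /unit_section /= /prod_degen /= /universal_degen gmulf1.
Qed.

Definition unshear_hom : sset_hom (twisted_product a) (borel_construction a) :=
  SSetHom unshear_face unshear_degen.

Lemma borel_shearK n : cancel (@borel_shear n) (@unshear n).
Proof.
move=> O; rewrite -{2}(borel_reprK O); apply/borel_class_eqP.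
rewrite /borel_shear; case: (borel_repr O) => [[g b] x].
(* Acting by $g$ takes the unit representative $((1,b),gx)$ back to $((g,b),x)$. *)
by exists g; rewrite /borel_act /unit_section /= mul1g -sactM mulVg sact1.
Qed.

Lemma unshearK n : cancel (@unshear n) (@borel_shear n).
Proof. by case=> b x; rewrite borel_shearE /shear /= sact1. Qed.

End ShearMap.

Lemma unshear_marked (G : sgroup) (X : msset) (a : msaction G X)
    (p : marked_twisted_product a 1) :
  marked p -> @marked (marked_borel_construction a) (shom (unshear_hom a) p).
Proof.
move=> pM; exists (unit_section p) => //.
case: pM => [[_ degx]|[[b0 _ bE] markx]]; [by left | right; split => //].
(* As $s_0 1=1$, the edge $(1,s_0 b_0)$ of $EG$ is $s_0(1,b_0)$. *)
by exists (1%g, b0) => //; rewrite /= /universal_degen /= gmulf1 -bE.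
Qed.

Lemma borel_shear_marked (G : sgroup) (X : msset) (a : msaction G X)
    (gs0_degenerate : forall (x : X 0) (g : G 1),
       degenerate_edge X (sact a g (degen ord0 x)))
    (O : marked_borel_construction a 1) :
  marked O -> @marked (marked_twisted_product a) (shom (borel_shear_hom a) O).
Proof.
case=> p pbox <-; rewrite /= borel_shearE.
case: pbox => [[_ [y _ xE]]|[[e _ eE] markx]].
  (* The second coordinate is now $g\cdot s_0(y)$, degenerate by [gs0_degenerate]. *)
  by left; split => //; rewrite /shear /= -xE.
right; split; last exact: msact_marked.
(* The projection $EG\to BG$ sends $s_0 e$ to the degeneracy of the base vertex of $e$. *)
by exists e.2 => //; rewrite /shear /= -eE.
Qed.

Theorem proposition5p3 (G : sgroup) (X : msset) (a : msaction G X)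
    (gs0_degenerate : forall (x : X 0) (g : G 1),
       degenerate_edge X (sact a g (degen ord0 x))) :
  msset_isomorphic (marked_borel_construction a) (marked_twisted_product a).
Proof.
exists (@MSSetHom (marked_borel_construction a) (marked_twisted_product a)
          (borel_shear_hom a) (@borel_shear_marked G X a gs0_degenerate)).
exists (@MSSetHom (marked_twisted_product a) (marked_borel_construction a)
          (unshear_hom a) (@unshear_marked G X a)).
by move=> n; split; [exact: borel_shearK | exact: unshearK].
Qed.
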